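(* Let $(G,T)$ be a bipartite graft and let $F\subseteq E(G)$ be a minimum join. For every edge $xy\in F$ (with the ends taken in this order), there exists a unique subgraph $K$ that is a decapital distance component of $(G,T)$ with respect to some root $r\in V(G)$ and such that $x$ and $y$ are the $F$-root and $F$-antiroot of $K$, respectively.
   Context: All graphs are finite. For a graph $G$ and $X\subseteq V(G)$, $\partial_G(X)$ is the set of edges with exactly one end in $X$, $\partial_G(v):=\partial_G(\{v\})$; for a subgraph $H$, $\partial_G(H):=\partial_G(V(H))$. A graft is a pair $(G,T)$ with $T\subseteq V(G)$ such that every connected component of $G$ contains an even number of vertices of $T$; it is bipartite if $G$ is bipartite. A join of $(G,T)$ is a set $F\subseteq E(G)$ such that $|\partial_G(v)\cap F|$ is odd for every $v\in T$ and even for every $v\in V(G)\setminus T$; a minimum join is a join with the minimum number of edges. For $F\subseteq E(G)$, $w_F(e)=-1$ if $e\in F$ and $w_F(e)=+1$ otherwise, extended additively to paths. For $x,y\in V(G)$, $d_F(x,y)$ is the minimum $F$-weight of a path in $G$ between $x$ and $y$ (for minimum joins this is independent of the choice of $F$). For a root $r$ and integer $i$, let $L_{\le i}(r)=\{x: d_F(r,x)\le i\}$. The distance components of $(G,T)$ with respect to $r$ are the connected components of $G[L_{\le i}(r)]$ for all $i\in\{d_F(r,x):x\in V(G)\}$; capital if containing $r$, decapital otherwise. It is known (Sebő) that for bipartite $(G,T)$ and a minimum join $F$, every decapital distance component $K$ (for any root) satisfies $|\partial_G(K)\cap F|=1$; this unique edge is the $F$-beam of $K$, its end in $V(K)$ is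 the $F$-root of $K$, its other end the $F$-antiroot of $K$. *)

(* Defs.v *)
From mathcomp Require Import all_boot all_order all_algebra.
From mathcomp Require Import boolp.

Set Implicit Arguments.
Unset Strict Implicit.
Unset Printing Implicit Defensive.

Import Order.TTheory GRing.Theory Num.Theory.
Local Open Scope ring_scope.

(** Finite undirected graphs with vertex type [V] and edge type [E].  Parallel
    edges are allowed (a simple graph is the case where [ends] is injective);
    loops are left out, as a bipartite graph has none. *)
Record graph (V E : finType) := Graph {
  ends : E -> {set V};
  card_ends : forall e, #|ends e| = 2%N }.

Section Graph.
Variables (V E : finType) (G : graph V E).
Implicit Types (x y r : V) (e : E) (X T : {set V}) (F : {set E}) (i d : int).

Definition cut X : {set E} := [set e | #|ends G e :&: X| == 1%N].

(** Some [X] is a colour class: every edge has exactly one end in it. *)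
Definition bipartite : Prop := exists X, forall e, e \in cut X.

(** A vertex set together with an edge set.  The subgraphs built below are
    [whole], [induced X] and their connected components, whose edges all have
    both ends in the vertex set. *)
Record subgraph := Subgraph { sverts : {set V}; sedges : {set E} }.
Implicit Types (H K : subgraph).

Definition whole : subgraph := Subgraph [set: V] [set: E].

Definition induced X : subgraph := Subgraph X [set e | ends G e \subset X].

Definition adj H : rel V :=
  [rel u v | [exists e in sedges H, ends G e == [set u; v]]].

Definition component_at H x : subgraph :=
  let C := [set u | connect (adj H) x u] in
  Subgraph C [set e in sedges H | ends G e \subset C].

Definition is_component H K : Prop :=
  exists2 x, x \in sverts H & K = component_at H x.

Definition graft T : Prop :=
  forall K, is_component whole K -> ~~ odd #|T :&: sverts K|.

Definition join T F : Prop :=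
  forall v, odd #|cut [set v] :&: F| = (v \in T).

Definition minimum_join T F : Prop :=
  join T F /\ forall F', join T F' -> (#|F| <= #|F'|)%N.

(** A walk from [x] is the list of its successive (edge, next vertex) steps;
    the empty list is the one-vertex walk. *)
Fixpoint walk x (p : seq (E * V)) : bool :=
  if p is (e, v) :: p' then (ends G e == [set x; v]) && walk v p' else true.

Definition path_between x y (p : seq (E * V)) : bool :=
  [&& walk x p, last x (unzip2 p) == y & uniq (x :: unzip2 p)].

Definition weight F e : int := if e \in F then -1 else 1.

Definition path_weight F (p : seq (E * V)) : int :=
  \sum_(s <- p) weight F s.1.

(** [is_dist F x y d] reads "d_F(x,y) = d"; it holds for no [d] when [x] and
    [y] lie in different connected components. *)
Definition is_dist F x y d : Prop :=
  (exists2 p, path_between x y p & path_weight F p = d) /\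
  (forall p, path_between x y p -> d <= path_weight F p).

Definition level_le F r i : {set V} :=
  [set x | `[< exists2 d, is_dist F r x d & d <= i >]].

Definition distance_component F r K : Prop :=
  exists i, (exists x, is_dist F r x i) /\
            is_component (induced (level_le F r i)) K.

Definition decapital_distance_component F r K : Prop :=
  distance_component F r K /\ r \notin sverts K.

Definition is_beam F K e : Prop := cut (sverts K) :&: F = [set e].

Definition is_Froot F K x : Prop :=
  exists2 e, is_beam F K e & x \in ends G e :&: sverts K.

Definition is_Fantiroot F K y : Prop :=
  exists2 e, is_beam F K e & y \in ends G e :\: sverts K.

End Graph.

(* Main.v *)
(** The distance from [r] is computed on edge sets: [lam v] is the minimum weight
    of an edge set whose odd-degree vertices are [r] and [v].  Let [K] be a
    component of a level set of [lam] that avoids [r].  Once the edges inside [K]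
    have weight 0, toggling a boundary edge in an optimal set reaching [K] shows
    that such a set crosses the boundary of [K] exactly in its negative edges;
    cutting an optimal set at its first entrance into [K] shows that there is only
    one.  Then the boundary edges of [K] may be given weight 0 as well: there is
    still no negative circuit (flip the sign along a zero circuit to contradict the
    uniqueness of the negative edge), and distances only grow by one on [K].
    Processing the decapital components by increasing size gives Sebo's theorem.

    For the edge [e = xy] of [F], the component of [x] in the level [-1] from [y]
    has beam [e].  Conversely let [K] have beam [e], with respect to any root.
    An optimal set from the root to [z] in [K] crosses the boundary of [K] at [e]
    only, so [z] is at distance at most [-1] from [y]; and an edge set joining [y]
    to another outer neighbour of [K] only loses weight under the contractions and
    then closes up through [K], so its weight is nonnegative.  Hence [K] is
    that component. *)
Require Import Defs.
From mathcomp Require Import all_boot all_order all_algebra.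
From mathcomp Require Import boolp zify.

Set Implicit Arguments.
Unset Strict Implicit.
Unset Printing Implicit Defensive.

Import Order.TTheory GRing.Theory Num.Theory.
Local Open Scope ring_scope.

(** * Symmetric differences and weights of edge sets *)

Section SymmetricDifference.
Variable I : finType.
Implicit Types A B : {set I}.

Definition symd A B : {set I} := [set e | (e \in A) (+) (e \in B)].

Lemma in_symd A B e : (e \in symd A B) = (e \in A) (+) (e \in B).
Proof. by rewrite inE. Qed.

Lemma symd_setD A B : B \subset A -> symd A B = A :\: B.
Proof.
move=> /subsetP sBA; apply/setP=> e; rewrite !inE.
by have := sBA e; case: (e \in B); case: (e \in A) => // /(_ isT).
Qed.

Lemma symdC A B : symd A B = symd B A.
Proof. by apply/setP=> e; rewrite !in_symd addbC. Qed.

Lemma symdK A B : symd (symd A B) B = A.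
Proof. by apply/setP=> e; rewrite !in_symd -addbA addbb addbF. Qed.

Definition wt (w : I -> int) A : int := \sum_(e in A) w e.

Lemma wtE w A : wt w A = \sum_e (if e \in A then w e else 0).
Proof. by rewrite /wt big_mkcond. Qed.

Lemma wt0 w : wt w set0 = 0.
Proof. by rewrite /wt big_set0. Qed.

Lemma wt1 w e : wt w [set e] = w e.
Proof. by rewrite /wt big_set1. Qed.

Lemma wt2 w e f : e != f -> wt w [set e; f] = w e + w f.
Proof. by move=> nef; rewrite /wt big_setU1 ?inE // big_set1. Qed.

Lemma wt_split w A B : wt w A = wt w (A :&: B) + wt w (A :\: B).
Proof.
rewrite !wtE -big_split /=; apply: eq_bigr => e _; rewrite !inE.
by case: (e \in A); case: (e \in B); rewrite ?addr0 ?add0r.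
Qed.

Lemma wt_setD w A B : B \subset A -> wt w A = wt w B + wt w (A :\: B).
Proof. by move=> /setIidPr sBA; rewrite (wt_split w A B) sBA. Qed.

Lemma wt_symd_zero w A B : (forall e, e \in B -> w e = 0) ->
  wt w (symd A B) = wt w A.
Proof.
move=> w0; rewrite !wtE; apply: eq_bigr => e _; rewrite in_symd.
case: (boolP (e \in B)) => [/w0->|_]; first by rewrite !if_same.
by rewrite addbF.
Qed.

Lemma wt_symd1 w A e :
  wt w (symd A [set e]) = wt w A + (if e \in A then - w e else w e).
Proof.
rewrite !wtE (bigD1 e) //= [in RHS](bigD1 e) //= in_symd inE eqxx.
rewrite (eq_bigr (fun f => if f \in A then w f else 0)) => [|f /negbTE nf].
  by case: (e \in A) => /=; lia.
by rewrite in_symd inE nf addbF.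
Qed.

(** The common part is counted twice, so [k] is minus its weight. Only the parity matters later:
    modulo 2, weight is additive under symmetric difference. *)
Lemma wt_symd w A B : exists k : int, wt w (symd A B) = wt w A + wt w B + k + k.
Proof.
exists (- wt w (A :&: B)); rewrite -addrA -opprD !wtE -!big_split -sumrB /=.
apply: eq_bigr => e _; rewrite !inE.
by case: (e \in A); case: (e \in B) => /=; lia.
Qed.

Definition flip (w : I -> int) A e : int := if e \in A then - w e else w e.

(** Measures [symd B A] relative to [A]: if [A] is optimal, nonnegativity under the flipped weights
    expresses exactly this optimality. *)
Lemma wt_flip w A B : wt (flip w A) B = wt w (symd B A) - wt w A.
Proof.
rewrite !wtE -sumrB; apply: eq_bigr => e _; rewrite in_symd /flip.
by case: (e \in A); case: (e \in B) => /=; lia.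
Qed.

End SymmetricDifference.

(** * Edge sets with prescribed odd-degree vertices, cuts and walks *)

Section Joins.
Variables (V E : finType) (G : graph V E).
Implicit Types (a b c v : V) (e : E) (J C P : {set E}) (K : {set V}).

(** Degree modulo 2, kept as a boolean so that symmetric difference becomes [addb]. *)
Definition deg J v : bool := \big[addb/false]_e ((e \in J) && (v \in ends G e)).

(* The odd-degree vertices of [J] are [a] and [b]; there is none if [a = b]. *)
Definition xyjoin a b J : bool := [forall v, deg J v == (v == a) (+) (v == b)].

Lemma xyjoinP a b J : reflect (forall v, deg J v = (v == a) (+) (v == b)) (xyjoin a b J).
Proof. exact: 'forall_eqP. Qed.

Lemma deg_symd J C v : deg (symd J C) v = deg J v (+) deg C v.
Proof.
rewrite /deg -big_split /=; apply: eq_bigr => e _; rewrite in_symd.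
by case: (e \in J); case: (e \in C); case: (v \in _).
Qed.

Lemma xyjoin_sym a b J : xyjoin a b J -> xyjoin b a J.
Proof. by move=> /xyjoinP h; apply/xyjoinP=> v; rewrite h addbC. Qed.

Lemma xyjoin_even a b J : xyjoin a a J -> xyjoin b b J.
Proof. by move=> /xyjoinP h; apply/xyjoinP=> v; rewrite h !addbb. Qed.

Lemma xyjoin_trans b a c J C : xyjoin a b J -> xyjoin b c C -> xyjoin a c (symd J C).
Proof.
move=> /xyjoinP hJ /xyjoinP hC; apply/xyjoinP=> v; rewrite deg_symd hJ hC.
by rewrite addbA -[_ (+) _ (+) (v == b)]addbA addbb addbF.
Qed.

Lemma xyjoin0 a : xyjoin a a set0.
Proof. by apply/xyjoinP=> v; rewrite addbb /deg big1 // => e _; rewrite inE. Qed.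

Lemma ends_neq e a b : ends G e = [set a; b] -> a != b.
Proof. by move=> h; have := card_ends G e; rewrite h cards2; case: eqP. Qed.

Lemma ends_setC e a b : ends G e = [set a; b] -> ends G e = [set b; a].
Proof. by rewrite setUC. Qed.

Lemma xyjoin1 e a b : ends G e = [set a; b] -> xyjoin a b [set e].
Proof.
move=> h; apply/xyjoinP=> v; rewrite /deg (bigD1 e) //= inE eqxx h !inE /=.
rewrite big1 ?addbF => [|f ne]; last by rewrite inE (negbTE ne).
by have := ends_neq h; case: (v =P a) => [->|] //=; case: eqP.
Qed.

Lemma endsP e : exists a b, ends G e = [set a; b].
Proof.
by have /eqP/cards2P[a [b [_ ?]]] := card_ends G e; exists a, b.
Qed.

Lemma cutE e K a b : ends G e = [set a; b] ->
  (e \in cut G K) = (a \in K) (+) (b \in K).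
Proof.
move=> h; have nab := ends_neq h; rewrite inE h setIUl.
rewrite cardsU; have -> : [set a] :&: K :&: ([set b] :&: K) = set0.
  apply/setP=> v; rewrite !inE; case: eqP => [->|] //=.
  by rewrite (negbTE nab) /= andbF.
have c1 c : #|[set c] :&: K| = (c \in K).
  case: (boolP (c \in K)) => hc.
    have -> : [set c] :&: K = [set c] by apply/setIidPl; rewrite sub1set.
    exact: cards1.
  have -> : [set c] :&: K = set0.
    by apply/setP=> v; rewrite !inE; case: eqP => // ->; rewrite (negbTE hc).
  exact: cards0.
by rewrite !c1 cards0; case: (a \in K); case: (b \in K).
Qed.

Lemma cutP e K : e \in cut G K ->
  exists a b, [/\ ends G e = [set a; b], a \in K & b \notin K].
Proof.
have [a [b h]] := endsP e; rewrite (cutE K h).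
case: (boolP (a \in K)) => ha; case: (boolP (b \in K)) => hb // _.
  by exists a, b.
by exists b, a; rewrite setUC.
Qed.

(** Double counting: an edge contributes once for each end in [K], so modulo 2 only the edges of the
    cut survive. *)
Lemma odd_cut K J :
  odd #|J :&: cut G K| = \big[addb/false]_(v in K) deg J v.
Proof.
rewrite /deg exchange_big /= -sum1_card big_mkcond /=.
rewrite (big_morph odd oddD (erefl : odd 0 = false)); apply: eq_bigr => e _.
have [a [b h]] := endsP e; have nab := ends_neq h.
rewrite inE (cutE K h); case: (e \in J) => /=; last by rewrite big1.
have -> : \big[addb/false]_(v in K) (v \in ends G e) = 
   \big[addb/false]_v ((v \in K) && (v \in ends G e)).
  by rewrite big_mkcond; apply: eq_bigr => v _; case: (v \in K).
rewrite (bigD1 a) // (bigD1 b) 1?eq_sym //= big1 => [|v /andP[na nb]].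
  by rewrite h !inE !eqxx orbT !andbT addbF; case: (a \in K); case: (b \in K).
by rewrite h !inE (negbTE na) (negbTE nb) andbF.
Qed.

Lemma odd_cut_xyjoin K J a b : xyjoin a b J ->
  odd #|J :&: cut G K| = (a \in K) (+) (b \in K).
Proof.
move=> /xyjoinP h; rewrite odd_cut (eq_bigr _ (fun v _ => h v)) big_split /=.
have c1 c : \big[addb/false]_(v in K) (v == c) = (c \in K).
  rewrite big_mkcond (bigD1 c) //= eqxx big1 => [|v /negbTE->].
    by case: (c \in K).
  by rewrite if_same.
by rewrite !c1.
Qed.

Lemma deg_odd J v : odd #|cut G [set v] :&: J| = deg J v.
Proof. by rewrite setIC odd_cut big_set1. Qed.

(** Spanning subgraph, so that [adj] and [connect] apply to a bare edge set. *)
Definition edge_subgraph J := Subgraph [set: V] J.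

Lemma adj_sym H : symmetric (adj G H).
Proof. by move=> a b; rewrite /adj /= setUC. Qed.

Lemma connect_adj_sym H : connect_sym (adj G H).
Proof. exact/sym_connect_sym/adj_sym. Qed.

Lemma adj_edge H e a b : e \in sedges H -> ends G e = [set a; b] -> adj G H a b.
Proof. by move=> he h; apply/existsP; exists e; rewrite he h eqxx. Qed.

Lemma connect_ind H (S : V -> Prop) a :
  S a -> (forall e c d, connect (adj G H) a c -> e \in sedges H ->
    ends G e = [set c; d] -> S c -> S d) ->
  forall b, connect (adj G H) a b -> S b.
Proof.
move=> Sa step b /connectP[p]; elim/last_ind: p b => [|p d IH] b /=.
  by move=> _ ->.
rewrite rcons_path last_rcons => /andP[hp /existsP[e /andP[he /eqP h]]] ->.
apply: step he h _; last exact: IH.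
by apply/connectP; exists p.
Qed.

Lemma connect_xyjoin J a b : connect (adj G (edge_subgraph J)) a b ->
  exists2 P : {set E}, P \subset J & xyjoin a b P.
Proof.
move: b; apply: connect_ind; first by exists set0; rewrite ?sub0set ?xyjoin0.
move=> e c d _ /= he h [P sP hP]; exists (symd P [set e]).
  apply/subsetP=> f; rewrite !inE; case: eqP => [->|_] //.
  by rewrite addbF => /(subsetP sP).
exact: xyjoin_trans hP (xyjoin1 h).
Qed.

(** No edge of [J] leaves the [J]-component of [a]. If [b] were outside it, parity would require
    such an edge. *)
Lemma xyjoin_connect J a b : xyjoin a b J -> connect (adj G (edge_subgraph J)) a b.
Proof.
move=> hj; pose A := [set v | connect (adj G (edge_subgraph J)) a v].
case: (boolP (b \in A)); first by rewrite inE.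
move=> nbA; have := odd_cut_xyjoin A hj; rewrite (negbTE nbA) inE connect0 /=.
case: (set_0Vmem (J :&: cut G A)) => [->|[e]]; first by rewrite cards0.
rewrite in_setI => /andP[eJ /cutP[c [d [h]]]]; rewrite !inE => hc hd _.
by case/negP: hd; apply: connect_trans hc (connect1 _); apply: (adj_edge (e := e)).
Qed.

(* The part of a walk up to its first vertex in [K]. *)
Lemma first_entrance J K a b : xyjoin a b J -> a \notin K -> b \in K ->
  exists (P : {set E}) c e, [/\ P \subset J, c \in K, xyjoin a c P & P :&: cut G K = [set e]].
Proof.
(* [A] is what [a] reaches in [J] without touching [K]. By parity some edge of [J] leaves [A], and
   it can only lead into [K]: it is the entrance. *)
move=> hj aK bK; pose J' := [set e in J | ends G e \subset ~: K].
pose A := [set v | connect (adj G (edge_subgraph J')) a v].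
have AK v : v \in A -> v \notin K.
  rewrite inE; move: v; apply: connect_ind => // e c d _ /=.
  rewrite inE => /andP[_ /subsetP s] h _.
  by have := s d; rewrite h !inE eqxx orbT => /(_ isT).
have nbA : b \notin A by apply: contraL bK => /AK.
have := odd_cut_xyjoin A hj; rewrite (negbTE nbA) inE connect0 /=.
case: (set_0Vmem (J :&: cut G A)) => [->|[e]]; first by rewrite cards0.
rewrite in_setI => /andP[eJ /cutP[c [d [h]]]] hc hd _.
have cK := AK _ hc; rewrite inE in hc.
have dK : d \in K.
  apply: contraR hd => dK; rewrite inE; apply: connect_trans hc (connect1 _).
  apply: (adj_edge (e := e)) (h); rewrite inE eJ h /=; apply/subsetP=> v.
  by rewrite !inE => /orP[] /eqP->.
have [P sP hP] := connect_xyjoin hc.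
have eP f : f \in P -> f \notin cut G K.
  move=> /(subsetP sP); rewrite inE => /andP[_ /subsetP s].
  by apply/negP=> /cutP[z [u [hf zK _]]]; have := s z; rewrite hf !inE eqxx zK => /(_ isT).
have ecut : e \in cut G K by rewrite (cutE K h) dK (negbTE cK).
exists (symd P [set e]), d, e; split=> //; last 1 first.
- apply/setP=> f; rewrite in_setI in_symd in_set1.
  case: eqP => [->|_]; last by rewrite addbF; case: (boolP (f \in P)) => //= /eP/negbTE.
  by rewrite ecut; case: (boolP (e \in P)) => // /eP; rewrite ecut.
- apply/subsetP=> f; rewrite !inE; case: eqP => [->|_] //.
  by rewrite addbF => /(subsetP sP); rewrite inE => /andP[].
exact: xyjoin_trans hP (xyjoin1 h).
Qed.

End Joins.

(** * Distance potentials and the contraction of one sink *)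

Section Potentials.
Variables (V E : finType) (G : graph V E).
Implicit Types (a b c v r : V) (e f : E) (J C P : {set E}) (K : {set V}).
Implicit Types (w : E -> int) (lam : V -> int).
Local Notation cut := (cut G).

(* [lam] is the distance from [r] for the weights [w], on the component of [r];
   [pot_le] at [v = r] says that [w] has no negative circuit. *)
Record potential w r lam : Prop := Potential {
  pot_root : lam r = 0;
  pot_le : forall v J, xyjoin G r v J -> lam v <= wt w J;
  pot_att : forall v J, xyjoin G r v J -> exists2 J0, xyjoin G r v J0 & wt w J0 = lam v;
  pot_even : forall C, xyjoin G r r C -> exists k : int, wt w C = k + k }.

(* [K] behaves like a single vertex of weight-zero edges, strictly closer to [r]
   than all its neighbours. *)
Record sink w r lam K : Prop := Sink {
  sink_root : r \notin K;
  sink_zero : forall a b, a \in K -> b \in K ->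
    exists2 P, xyjoin G a b P & forall e, e \in P -> w e = 0 /\ e \notin cut K;
  sink_cut : forall e a b, ends G e = [set a; b] -> a \in K -> b \notin K ->
    lam b = lam a + 1 /\ (w e = 1 \/ w e = -1);
  sink_reach : exists a J, a \in K /\ xyjoin G r a J }.

Definition negs w K := [set e in cut K | w e == -1].

Definition zero_cut w K e : int := if e \in cut K then 0 else w e.

(** An optimal set reaching [K] uses one boundary edge, of weight -1. Setting it to 0 costs one
    unit, hence the shift on [K]. *)
Definition raise lam K v : int := lam v + (v \in K)%:R.

Lemma wt_zero_cut w K J : wt w J = wt (zero_cut w K) J + wt w (J :&: cut K).
Proof.
rewrite !wtE -big_split; apply: eq_bigr => e _ /=.
by rewrite in_setI /zero_cut; case: (e \in J); case: (e \in cut K) => /=; lia.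
Qed.

Section Step.
Variables (w : E -> int) (r : V) (lam : V -> int) (K : {set V}).
Hypotheses (pot : potential w r lam) (snk : sink w r lam K).

Lemma pot_cons C a : xyjoin G a a C -> 0 <= wt w C.
Proof. by move=> /(xyjoin_even r)/(pot_le pot); rewrite (pot_root pot). Qed.

(** The end of [J] moves from [a] to [b] along weight-zero edges. *)
Lemma sink_le a b J : a \in K -> b \in K -> xyjoin G r a J -> lam b <= wt w J.
Proof.
move=> aK bK hJ; have [P hP P0] := sink_zero snk aK bK.
rewrite -(wt_symd_zero (B := P) J) => [|e /P0[]//].
exact: pot_le pot _ _ (xyjoin_trans hJ hP).
Qed.

Lemma sink_reachK a : a \in K -> exists J, xyjoin G r a J.
Proof.
move=> aK; have [b [J [bK hJ]]] := sink_reach snk.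
by have [P hP _] := sink_zero snk bK aK; exists (symd J P); apply: xyjoin_trans hP.
Qed.

Lemma sink_const a b : a \in K -> b \in K -> lam a = lam b.
Proof.
move=> aK bK; have [J hJ] := sink_reachK aK; have [J' hJ'] := sink_reachK bK.
have [Ja ha ea] := pot_att pot hJ; have [Jb hb eb] := pot_att pot hJ'.
by have := sink_le aK bK ha; have := sink_le bK aK hb; lia.
Qed.

(* Toggling a boundary edge [e] in an optimal [J] reaches a neighbour of [K],
   which is farther from [r] by one. *)
Lemma optimal_cut a J e : a \in K -> xyjoin G r a J -> wt w J = lam a ->
  e \in cut K -> (e \in J) = (w e == -1).
Proof.
move=> aK hJ oJ /cutP[c [u [he cK uK]]].
have [hl hw] := sink_cut snk he cK uK.
have [P hP P0] := sink_zero snk aK cK.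
have := pot_le pot (xyjoin_trans (xyjoin_trans hJ hP) (xyjoin1 he)).
have eP : e \notin P.
  by apply/negP=> /P0[_]; rewrite (cutE K he) cK (negbTE uK).
rewrite wt_symd1 wt_symd_zero => [|f /P0[]//].
rewrite in_symd (negbTE eP) addbF oJ hl (sink_const aK cK).
by case: (e \in J); case: hw => -> //=; lia.
Qed.

Lemma optimal_setI a J : a \in K -> xyjoin G r a J -> wt w J = lam a ->
  J :&: cut K = negs w K.
Proof.
move=> aK hJ oJ; apply/setP=> e; rewrite in_setI [in RHS]inE -andbC.
by case: (boolP (e \in cut K)) => //= he; rewrite -(optimal_cut aK hJ oJ he).
Qed.

(** An optimal set meets the boundary exactly in the negative edges. The part up to the first
    entrance into [K] is still optimal, and it crosses only once. *)
Lemma negs1 : exists f, negs w K = [set f].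
Proof.
have [a [J' [aK hJ']]] := sink_reach snk; have [J hJ oJ] := pot_att pot hJ'.
have [P [c [f [sP cK hP eP]]]] := first_entrance hJ (sink_root snk) aK.
exists f; rewrite -eP; symmetry; apply: (optimal_setI cK hP).
have [Q hQ Q0] := sink_zero snk aK cK.
(* The rest of [J] after [P] closes up through [K] along [Q] at no cost, so its weight is
   nonnegative and [P] weighs at most as much as [J]. *)
have h : xyjoin G c c (symd (symd P J) Q).
  exact: xyjoin_trans (xyjoin_trans (xyjoin_sym hP) hJ) hQ.
have := pot_cons h; rewrite wt_symd_zero => [|e /Q0[]//].
have -> : symd P J = J :\: P.
  by rewrite -(symd_setD sP) symdC.
have := wt_setD w sP; have := pot_le pot hP; rewrite oJ (sink_const aK cK).
by lia.
Qed.

End Step.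

(* Re-rooting at [v]: distances shift by a constant when an optimal set to [v]
   is flipped. *)
Lemma flip_potential w r lam v J0 : potential w r lam ->
  xyjoin G r v J0 -> wt w J0 = lam v ->
  potential (flip w J0) v (fun u => lam u - lam v).
Proof.
move=> pot h0 o0; split; first by rewrite subrr.
- move=> u J hJ; rewrite wt_flip o0 lerB //.
  apply: pot_le pot _ _ _; have := xyjoin_trans h0 hJ.
  by rewrite symdC.
- move=> u J hJ; have [J1 h1 o1] := pot_att pot (xyjoin_trans h0 hJ).
  exists (symd J1 J0); last by rewrite wt_flip symdK o0 o1.
  have := xyjoin_trans (xyjoin_sym h0) h1.
  by rewrite symdC.
- move=> C /(xyjoin_even r)/(pot_even pot)[k ek]; rewrite wt_flip.
  by have [l ->] := wt_symd w C J0; rewrite ek; exists (k + l); lia.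
Qed.

(** Flipping preserves 0 and swaps 1 with -1, and the sink conditions involve only differences of
    [lam]. *)
Lemma flip_sink w r lam v J0 K : sink w r lam K -> xyjoin G r v J0 -> v \notin K ->
  sink (flip w J0) v (fun u => lam u - lam v) K.
Proof.
move=> snk h0 vK; split=> //.
- move=> a b aK bK; have [P hP P0] := sink_zero snk aK bK.
  exists P => // e /P0[e0 ->]; split=> //.
  by rewrite /flip e0; case: ifP; lia.
- move=> e a b he aK bK; have [hl hw] := sink_cut snk he aK bK.
  by rewrite /flip; split; [|case: ifP; case: hw => ->]; lia.
- have [a [J [aK hJ]]] := sink_reach snk.
  by exists a, (symd J0 J); split=> //; apply: xyjoin_trans (xyjoin_sym h0) hJ.
Qed.

(** Zeroing the boundary subtracts [w e + w f]. This can hurt only when both are 1, and then, by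
    parity, only if [C] has weight 0. *)
Lemma zero_cut_even2 w r lam K C a e f : potential w r lam -> sink w r lam K ->
  xyjoin G a a C -> e != f -> C :&: cut K = [set e; f] -> 0 <= wt (zero_cut w K) C.
Proof.
move=> pot snk hC nef eC.
have hcut g : g \in [set e; f] -> g \in C /\ g \in cut K.
  by rewrite -eC in_setI => /andP.
have [eC' ecut] : e \in C /\ e \in cut K by apply: hcut; rewrite !inE eqxx.
have [fC' fcut] : f \in C /\ f \in cut K by apply: hcut; rewrite !inE eqxx orbT.
have w1 g : g \in cut K -> w g = 1 \/ w g = -1.
  by move=> /cutP[c [d [h cK dK]]]; case: (sink_cut snk h cK dK).
have := wt_zero_cut w K C; rewrite eC wt2 //.
have := pot_cons pot hC.
case: (w1 _ ecut) => we; case: (w1 _ fcut) => wf; try by rewrite we wf; lia.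
have [k ek] := pot_even pot (xyjoin_even r hC).
(* A circuit of weight 0 could be flipped, giving [K] two negative edges. *)
rewrite we wf; suff : wt w C <> 0 by lia.
move=> C0; have hC' := xyjoin_even r hC.
have o : wt w C = lam r by rewrite (pot_root pot).
have [g eg] := negs1 (flip_potential pot hC' o)
  (flip_sink snk hC' (sink_root snk)).
have he : e \in [set g] by rewrite -eg inE ecut /flip eC' we.
have hf : f \in [set g] by rewrite -eg inE fcut /flip fC' wf.
by move: he hf nef; rewrite !inE => /eqP-> /eqP->; rewrite eqxx.
Qed.

(** Induction on the number of boundary edges of [C]: split off a part that leaves [K] once and
    returns once. Both pieces are closed up inside [K] by weight-zero edges. *)
Lemma zero_cut_cons w r lam K C a : potential w r lam -> sink w r lam K ->
  xyjoin G a a C -> 0 <= wt (zero_cut w K) C.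
Proof.
move=> pot snk; move: {2}_.+1 (ltnSn #|C :&: cut K|) => n.
elim: n C a => // n IH C a hn hC.
case: (set_0Vmem (C :&: cut K)) => [C0|[g]].
  by have := wt_zero_cut w K C; rewrite C0 wt0 addr0 => <-; apply: pot_cons pot _ _ hC.
rewrite in_setI => /andP[gC gcut]; have [z [u [hg zK uK]]] := cutP gcut.
have hJ : xyjoin G u z (symd C [set g]).
  exact: xyjoin_trans (xyjoin_even u hC) (xyjoin_sym (xyjoin1 hg)).
have [P [c [e [sP cK hP eP]]]] := first_entrance hJ uK zK.
have gP : g \notin P.
  by apply/negP=> /(subsetP sP); rewrite in_symd gC inE eqxx.
have eP' : e \in P :&: cut K by rewrite eP inE.
have neg : e != g.
  by apply: contraNneq gP => <-; move: eP'; rewrite in_setI => /andP[].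
(* [D] leaves [K] through [g] and returns through [e]; [Q] closes it, and the same [Q] closes the
   remainder [C :\: D]. *)
pose D := g |: P.
have eD : D = symd [set g] P.
  apply/setP=> h; rewrite !inE; case: eqP => // ->.
  by rewrite (negbTE gP).
have sD : D \subset C.
  apply/subsetP=> h; rewrite !inE => /orP[/eqP->//|hh].
  have := subsetP sP _ hh; rewrite !inE; case: eqP => [->//|_].
  by rewrite addbF.
have hD : xyjoin G z c D by rewrite eD; apply: xyjoin_trans (xyjoin1 hg) hP.
have [Q hQ Q0] := sink_zero snk cK zK.
have Q0' h : h \in Q -> zero_cut w K h = 0.
  by move=> /Q0[h0 hc]; rewrite /zero_cut h0 if_same.
have hDQ : xyjoin G z z (symd D Q) by apply: xyjoin_trans hQ.
have Qcut h : h \in cut K -> h \in Q = false.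
  by move=> hc; apply/negP=> /Q0[_]; rewrite hc.
have DQ : symd D Q :&: cut K = [set e; g].
  apply/setP=> h; rewrite in_setI in_symd in_set2 [h \in D]in_setU1.
  case: (boolP (h \in cut K)) => hc; rewrite ?andbF ?andbT.
    rewrite Qcut // addbF orbC; congr (_ || _).
    by move/setP/(_ h): (eP); rewrite in_setI in_set1 hc andbT.
  symmetry; apply/negbTE; apply: contra hc => /orP[] /eqP-> //.
  by move: eP'; rewrite in_setI => /andP[].
rewrite (wt_setD _ sD) addr_ge0 //.
  rewrite -(wt_symd_zero D Q0').
  exact: zero_cut_even2 pot snk hDQ neg DQ.
rewrite -(wt_symd_zero _ Q0').
have hC' : xyjoin G z z (symd (C :\: D) Q).
  rewrite -(symd_setD sD); apply: xyjoin_trans hQ; apply: xyjoin_trans (xyjoin_even z hC) hD.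
apply: IH hC'; rewrite ltnS in hn; apply: leq_trans hn.
apply: proper_card; apply/properP; split.
  apply/subsetP=> h; rewrite !in_setI in_symd => /andP[+ hc]; rewrite hc Qcut // addbF andbT.
  by rewrite in_setD => /andP[].
exists g; first by rewrite in_setI gC.
by rewrite in_setI in_symd Qcut // gcut in_setD !inE eqxx.
Qed.

(** * Weights and distances after contracting a sink *)

Section StepConclusion.
Variables (w : E -> int) (r : V) (lam : V -> int) (K : {set V}).
Hypotheses (pot : potential w r lam) (snk : sink w r lam K).

(** Compare the negative boundary edge [f] seen from [r] with the one [g] seen from [v]. Either [J]
    avoids the boundary, or it crosses exactly at [f] and [g], whose weights -1 and 1 cancel. *)
Lemma optimal_out v J : v \notin K -> xyjoin G r v J -> wt w J = lam v ->
  wt (zero_cut w K) J = wt w J.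
Proof.
move=> vK hJ oJ; suff : wt w (J :&: cut K) = 0.
  by have := wt_zero_cut w K J; lia.
have [f ef] := negs1 pot snk.
have [g eg] := negs1 (flip_potential pot hJ oJ) (flip_sink snk hJ vK).
have w1 h : h \in cut K -> w h = 1 \/ w h = -1.
  by move=> /cutP[c [d [hh cK dK]]]; case: (sink_cut snk hh cK dK).
(* A boundary edge lies in [J] exactly when its sign differs between [w] and [flip w J]. *)
have eJ : J :&: cut K = symd [set f] [set g].
  apply/setP=> h; rewrite in_symd -ef -eg in_setI [h \in negs w K]inE.
  rewrite [h \in negs (flip w J) K]inE.
  case: (boolP (h \in cut K)) => hc; rewrite ?andbF ?andbT //= /flip.
  by case: (w1 _ hc) => ->; case: (h \in J).
rewrite eJ; have [->|nfg] := eqVneq f g.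
  by rewrite (_ : symd _ _ = set0) ?wt0 //; apply/setP=> h; rewrite !inE addbb.
have -> : symd [set f] [set g] = [set f; g].
  by apply/setP=> h; rewrite !inE; case: (h =P f) => [->|] //=.
rewrite wt2 //.
have : f \in negs w K by rewrite ef inE.
rewrite inE => /andP[_ /eqP->].
have gJ : g \in J :&: cut K by rewrite eJ !inE eqxx eq_sym (negbTE nfg).
move: gJ; rewrite in_setI => /andP[_ gc]; case: (w1 _ gc) => [->//|wg].
have : g \in negs w K by rewrite inE gc wg eqxx.
by rewrite ef inE eq_sym (negbTE nfg).
Qed.

Lemma optimal_zero_cut v J : xyjoin G r v J -> wt w J = lam v ->
  wt (zero_cut w K) J = raise lam K v.
Proof.
move=> hJ oJ; rewrite /raise; case: (boolP (v \in K)) => vK /=.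
  have [f ef] := negs1 pot snk.
  have := wt_zero_cut w K J; rewrite (optimal_setI pot snk vK hJ oJ) ef wt1.
  have : f \in negs w K by rewrite ef inE.
  by rewrite inE => /andP[_ /eqP->]; rewrite oJ; lia.
by rewrite (optimal_out vK hJ oJ) addr0.
Qed.

(** Outside [K], re-root at the end of an optimal set and apply [zero_cut_cons] to the flipped
    weights. Inside [K], first leave through a boundary edge, now free, to a neighbour at distance
    one more. *)
Lemma zero_cut_le v J : xyjoin G r v J -> raise lam K v <= wt (zero_cut w K) J.
Proof.
have out u C : u \notin K -> xyjoin G r u C -> lam u <= wt (zero_cut w K) C.
  move=> uK hC; have [J0 h0 o0] := pot_att pot hC.
  have := zero_cut_cons (flip_potential pot h0 o0) (flip_sink snk h0 uK)
            (xyjoin_trans (xyjoin_sym hC) h0).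
  (* Zeroing the boundary commutes with flipping signs. *)
  rewrite (_ : wt _ _ = wt (flip (zero_cut w K) J0) (symd C J0)).
    by rewrite wt_flip symdK (optimal_out uK h0 o0) o0; lia.
  apply: eq_bigr => e _; rewrite /zero_cut /flip.
  by case: ifP => //; case: ifP.
move=> hJ; rewrite /raise; case: (boolP (v \in K)) => vK /=; last first.
  by rewrite addr0; apply: out.
have [f ef] := negs1 pot snk.
have : f \in negs w K by rewrite ef inE.
rewrite inE => /andP[fc _]; have [a [b [hf aK bK]]] := cutP fc.
have [P hP P0] := sink_zero snk vK aK.
have := out _ _ bK (xyjoin_trans (xyjoin_trans hJ hP) (xyjoin1 hf)).
rewrite !wt_symd_zero => [|e /P0[e0 _]|e]; last 2 first.
- by rewrite /zero_cut e0 if_same.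
- by rewrite inE => /eqP->; rewrite /zero_cut fc.
by have [-> _] := sink_cut snk hf aK bK; rewrite (sink_const pot snk vK aK).
Qed.

Lemma zero_cut_potential : potential (zero_cut w K) r (raise lam K).
Proof.
split; last 1 first.
- move=> C hC; have [k ek] := pot_even pot hC.
  have := odd_cut_xyjoin K hC; rewrite addbb => oC.
  suff [l el] : exists l : int, wt w (C :&: cut K) = l + l.
    by have := wt_zero_cut w K C; rewrite ek el => h; exists (k - l); lia.
  (* Boundary edges weigh 1 or -1, so weight and cardinality have the same parity; [C] meets the
     boundary in an even number of edges. *)
  have : forall D : {set E}, D \subset cut K ->
      exists l : int, wt w D = l + l + (odd #|D|)%:R.
    move=> D; move: {2}_.+1 (ltnSn #|D|) => n; elim: n D => // n IH D hn sD.
    case: (set_0Vmem D) => [->|[e eD]]; first by exists 0; rewrite wt0 cards0.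
    rewrite (cardsD1 e) eD oddD /= in hn *.
    have [|l el] := IH (D :\ e) hn; first by apply: subset_trans sD; apply: subsetDl.
    have /cutP[a [b [he aK bK]]] := subsetP sD _ eD.
    have [_ hw] := sink_cut snk he aK bK.
    have -> : wt w D = w e + wt w (D :\ e) by rewrite /wt (big_setD1 e).
    rewrite el; case: (odd _) => /=; case: hw => ->.
    + by exists (l + 1); lia.
    + by exists l; lia.
    + by exists l; lia.
    + by exists (l - 1); lia.
  move=> /(_ _ (subsetIr C (cut K))) [l ->]; rewrite oC.
  by exists l; rewrite addr0.
- by rewrite /raise (negbTE (sink_root snk)) addr0 (pot_root pot).
- exact: zero_cut_le.
- move=> v J hJ; have [J0 h0 o0] := pot_att pot hJ.
  by exists J0 => //; apply: optimal_zero_cut.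
Qed.

(** With both ends outside [K], [J] crosses the boundary an even number of times. The single
    negative edge, if used, is offset by a positive one, so the erased weight is nonnegative. *)
Lemma zero_cut_decr a b J : xyjoin G a b J -> a \notin K -> b \notin K ->
  wt (zero_cut w K) J <= wt w J.
Proof.
move=> hJ aK bK; rewrite (wt_zero_cut w K J) lerDl.
have := odd_cut_xyjoin K hJ; rewrite (negbTE aK) (negbTE bK) /=.
have [f ef] := negs1 pot snk.
have w1 h : h \in J :&: cut K -> h != f -> w h = 1.
  rewrite in_setI => /andP[_ hc] nf; have /cutP[c [d [hh cK dK]]] := hc.
  have [_ [//|wh]] := sink_cut snk hh cK dK.
  have : h \in negs w K by rewrite inE hc wh eqxx.
  by rewrite ef inE (negbTE nf).
case: (boolP (f \in J :&: cut K)) => fJ ev.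
  have wf : w f = -1.
    have : f \in negs w K by rewrite ef inE.
    by rewrite inE => /andP[_ /eqP].
  rewrite /wt (big_setD1 f) //= wf; rewrite (cardsD1 f) fJ /= in ev.
  case: (set_0Vmem ((J :&: cut K) :\ f)) => [e0|[g gJ]].
    by rewrite e0 cards0 in ev.
  rewrite (big_setD1 g) //=; move: (gJ); rewrite in_setD1 => /andP[ng gJ'].
  rewrite (w1 _ gJ' ng) addrA addNr add0r; apply: sumr_ge0 => h.
  by rewrite !in_setD1 => /andP[_ /andP[nh hJ']]; rewrite (w1 _ hJ' nh).
apply: sumr_ge0 => h hJ'; rewrite (w1 _ hJ') //.
by apply: contraNneq fJ => <-.
Qed.

End StepConclusion.
End Potentials.

(** * Distances for the weights of [F] *)

Section Distance.
Variables (V E : finType) (G : graph V E) (F : {set E}).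
Implicit Types (a b c v r x y z : V) (e f : E) (J C P : {set E}) (K : {set V}).
Implicit Types (Q : {set {set V}}).
Local Notation cut := (cut G).
Local Notation w := (weight F).

Lemma weight1 e : w e = 1 \/ w e = -1.
Proof. by rewrite /weight; case: ifP; [right|left]. Qed.

Lemma weightN1 e : (w e == -1) = (e \in F).
Proof. by rewrite /weight; case: ifP. Qed.

Definition reach r v : bool := [exists J : {set E}, xyjoin G r v J].

Lemma reachI r v J : xyjoin G r v J -> reach r v.
Proof. by move=> h; apply/existsP; exists J. Qed.

(** The value 0 is only a default for [v] outside the component of [r]; [reach] guards against
    it. *)
Definition dist r v : int :=
  if [pick J | xyjoin G r v J] is Some J0 then
    wt w [arg min_(J < J0 | xyjoin G r v J) wt w J]%O
  else 0.

Lemma dist_att r v : reach r v -> exists2 J, xyjoin G r v J & wt w J = dist r v.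
Proof.
rewrite /dist => /existsP[J hJ]; case: pickP => [J0 h0|/(_ J)]; last by rewrite hJ.
by case: arg_minP => // J1 h1 _; exists J1.
Qed.

Lemma dist_le r v J : xyjoin G r v J -> dist r v <= wt w J.
Proof.
rewrite /dist => hJ; case: pickP => [J0 h0|/(_ J)]; last by rewrite hJ.
by case: arg_minP => // J1 _; apply.
Qed.

Lemma walk_ends x p e v : walk G x p -> e \in unzip1 p -> v \in ends G e ->
  v \in x :: unzip2 p.
Proof.
elim: p x => //= [[f u] p] IH x /andP[/eqP hf hp]; rewrite inE => /orP[/eqP->|].
  by rewrite hf !inE => /orP[]->; rewrite ?orbT.
by move=> he hv; rewrite in_cons (IH u) ?orbT.
Qed.

(** Distinct vertices force distinct edges, so the weight along the list is that of the edge set. *)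
Lemma path_xyjoin x p : walk G x p -> uniq (x :: unzip2 p) ->
  xyjoin G x (last x (unzip2 p)) [set e in unzip1 p] /\
  wt w [set e in unzip1 p] = path_weight F p.
Proof.
elim: p x => [|[f u] p IH] x /=.
  rewrite (_ : [set e in [::]] = set0); last by apply/setP=> e; rewrite !inE.
  by rewrite xyjoin0 wt0 /path_weight big_nil.
move=> /andP[/eqP hf hp] /andP[nx up]; have [hj hw] := IH u hp up.
have nf : f \notin unzip1 p.
  apply: contra nx => fp; apply: (walk_ends hp fp).
  by rewrite hf !inE eqxx.
have eS : [set e in f :: unzip1 p] = symd [set f] [set e in unzip1 p].
  by apply/setP=> e; rewrite !inE; case: eqP => [->|] //=; rewrite (negbTE nf).
have eS' : [set e in f :: unzip1 p] = f |: [set e in unzip1 p].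
  by apply/setP=> e; rewrite !inE.
split; first by rewrite eS; apply: xyjoin_trans (xyjoin1 hf) hj.
rewrite eS' /wt big_setU1 ?inE //= /path_weight big_cons /=.
by rewrite -/(wt _ _) hw.
Qed.

Lemma lift_path J x q : path (adj G (edge_subgraph V J)) x q ->
  exists p, [/\ walk G x p, unzip2 p = q & {subset unzip1 p <= J}].
Proof.
elim: q x => [|u q IH] x /=; first by exists [::].
move=> /andP[/existsP[e /andP[/= eJ /eqP he]] /IH[p [hp hq sp]]].
exists ((e, u) :: p); split=> /=; first by rewrite he eqxx.
  by rewrite hq.
by move=> f; rewrite inE => /orP[/eqP->|/sp].
Qed.

(** There is no negative circuit, and even-degree sets have even weight; minimality of the join and
    bipartiteness will supply these. *)
Hypothesis cons : forall a C, xyjoin G a a C -> 0 <= wt w C.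
Hypothesis even : forall a C, xyjoin G a a C -> exists k : int, wt w C = k + k.

(** Removing the edges of a path from [J] leaves a set of even degrees, of nonnegative weight. *)
Lemma xyjoin_path x y J : xyjoin G x y J ->
  exists2 p, path_between G x y p & path_weight F p <= wt w J.
Proof.
move=> hj; have /connectP[q hq] := xyjoin_connect hj.
case: (shortenP hq) => q' hq' uq' _ ey.
have [p [hp eq sp]] := lift_path hq'; rewrite -eq in uq' ey.
exists p; first by rewrite /path_between hp -ey eqxx uq'.
have [hj' <-] := path_xyjoin hp uq'.
have sS : [set e in unzip1 p] \subset J by apply/subsetP=> e; rewrite inE => /sp.
rewrite (wt_setD w sS) lerDl; apply: (cons (a := x)).
by rewrite -(symd_setD sS); apply: xyjoin_trans (xyjoin_sym hj'); rewrite -ey.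
Qed.

Lemma is_distP r x d : is_dist G F r x d <-> reach r x /\ d = dist r x.
Proof.
have bet p : path_between G r x p ->
    exists2 J, xyjoin G r x J & wt w J = path_weight F p.
  move=> /and3P[hp /eqP <- up]; have [h1 h2] := path_xyjoin hp up.
  by exists [set e in unzip1 p].
split=> [[[p hp <-] hmin]|[hr ->]].
  have [J hJ eJ] := bet _ hp; split; first exact: reachI hJ.
  apply/eqP; rewrite eq_le -{2}eJ dist_le // andbT.
  have [J0 h0 <-] := dist_att (reachI hJ).
  by have [p' hp' le'] := xyjoin_path h0; apply: le_trans le'; apply: hmin.
have ge p : path_between G r x p -> dist r x <= path_weight F p.
  by move=> /bet[J hJ <-]; apply: dist_le.
split=> //; have [J hJ eJ] := dist_att hr; have [p hp le] := xyjoin_path hJ.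
by exists p => //; apply/eqP; rewrite eq_le ge // andbT -eJ.
Qed.

Lemma in_level r i x : (x \in level_le G F r i) = reach r x && (dist r x <= i).
Proof.
rewrite inE; apply/asboolP/andP => [[d /is_distP[hr ->] le]|[hr le]] //.
by exists (dist r x) => //; apply/is_distP.
Qed.

Lemma dist_root r : dist r r = 0.
Proof.
apply/eqP; rewrite eq_le -{1}(wt0 w) dist_le ?xyjoin0 //=.
by have [J /cons h <-] := dist_att (reachI (xyjoin0 G r)).
Qed.

Lemma dist_potential r : potential G w r (dist r).
Proof.
split; [exact: dist_root | exact: dist_le | | exact: even].
by move=> v J /reachI/dist_att.
Qed.

Lemma reach_edge r e a b : ends G e = [set a; b] -> reach r a -> reach r b.
Proof. by move=> he /existsP[J hJ]; apply: reachI (xyjoin_trans hJ (xyjoin1 he)). Qed.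

(** Adding or removing [e] changes the weight by one, which bounds the difference; parity excludes
    equality. *)
Lemma dist_edge r e a b : ends G e = [set a; b] -> reach r a ->
  dist r b = dist r a + 1 \/ dist r b = dist r a - 1.
Proof.
move=> he ra; have rb := reach_edge he ra.
have [Ja ha ea] := dist_att ra; have [Jb hb eb] := dist_att rb.
have := dist_le (xyjoin_trans ha (xyjoin1 he)).
have := dist_le (xyjoin_trans hb (xyjoin_sym (xyjoin1 he))).
have [k] := even (xyjoin_trans (xyjoin_trans ha (xyjoin1 he)) (xyjoin_sym hb)).
have [l ->] := wt_symd w (symd Ja [set e]) Jb.
rewrite !wt_symd1 ea eb; case: (weight1 e) => ->; do 2!case: ifP => _; lia.
Qed.

(** * Level components and decapital components *)

Definition dcomp r z : {set V} :=
  [set u | connect (adj G (induced G (level_le G F r (dist r z)))) z u].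

Lemma in_dcomp r z u : (u \in dcomp r z) =
  connect (adj G (induced G (level_le G F r (dist r z)))) z u.
Proof. by rewrite in_set. Qed.

Lemma dcomp_self r z : z \in dcomp r z.
Proof. by rewrite inE connect0. Qed.

Lemma dcomp_le r z a : reach r z -> a \in dcomp r z ->
  reach r a /\ dist r a <= dist r z.
Proof.
move=> rz; rewrite inE; move: a; apply: connect_ind => // e c d _ /=.
rewrite inE => /subsetP s he _.
have : d \in level_le G F r (dist r z) by apply: s; rewrite he in_set2 eqxx orbT.
by rewrite in_level => /andP.
Qed.

Lemma dcomp_edge r z e a b : reach r z -> ends G e = [set a; b] ->
  a \in dcomp r z -> dist r b <= dist r z -> b \in dcomp r z.
Proof.
move=> rz he ha lb; have [ra la] := dcomp_le rz ha; have rb := reach_edge he ra.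
move: ha; rewrite !in_set => ha; apply: connect_trans ha (connect1 _).
apply: (adj_edge (e := e)) (he); rewrite inE he; apply/subsetP=> v.
by rewrite in_set2 => /orP[] /eqP->; rewrite in_level ?ra ?rb.
Qed.

(** The outer end lies above the level and distances change by one along an edge, so the inner end
    lies exactly on the level. *)
Lemma dcomp_cut r z e a b : reach r z -> ends G e = [set a; b] ->
  a \in dcomp r z -> b \notin dcomp r z ->
  dist r a = dist r z /\ dist r b = dist r z + 1.
Proof.
move=> rz he ha hb; have [ra la] := dcomp_le rz ha.
have : ~~ (dist r b <= dist r z).
  by apply: contra hb => lb; apply: dcomp_edge he ha lb.
by have := dist_edge he ra; lia.
Qed.

Lemma connect_level r i j a b : i <= j ->
  connect (adj G (induced G (level_le G F r i))) a b ->
  connect (adj G (induced G (level_le G F r j))) a b.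
Proof.
move=> ij; apply: connect_sub => u v /existsP[e /andP[]] /=.
rewrite inE => /subsetP s /eqP he; apply: connect1; apply: (adj_edge (e := e)) he.
rewrite inE; apply/subsetP=> c /s; rewrite !in_level => /andP[-> /=] h.
exact: le_trans h ij.
Qed.

Lemma dcomp_sub r z a : reach r z -> a \in dcomp r z -> dcomp r a \subset dcomp r z.
Proof.
move=> rz ha; have [_ la] := dcomp_le rz ha; apply/subsetP=> u.
rewrite !in_set in ha * => hu; apply: connect_trans ha _.
exact: connect_level la hu.
Qed.

Lemma dcomp_eq r z a : reach r z -> a \in dcomp r z -> dist r a = dist r z ->
  dcomp r a = dcomp r z.
Proof.
move=> rz; rewrite in_set => ha ea; apply/setP=> u; rewrite !in_set ea.
by rewrite (same_connect (@connect_adj_sym _ _ G _) ha).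
Qed.

Definition decapital r : {set {set V}} :=
  [set K | [exists z, [&& reach r z, r \notin dcomp r z & K == dcomp r z]]].

Lemma decapitalP r K :
  reflect (exists z, [/\ reach r z, r \notin dcomp r z & K = dcomp r z])
    (K \in decapital r).
Proof.
rewrite inE; apply: (iffP existsP) => [[z /and3P[? ? /eqP]]|[z [? ? ->]]]; exists z => //.
by apply/and3P.
Qed.

Lemma decapital_root r K : K \in decapital r -> r \notin K.
Proof. by move=> /decapitalP[z [_ ? ->]]. Qed.

Lemma decapital_cut r K e a b : K \in decapital r -> ends G e = [set a; b] ->
  a \in K -> b \notin K ->
  [/\ reach r a, K = dcomp r a & dist r b = dist r a + 1].
Proof.
move=> /decapitalP[z [rz _ ->]] he ha hb; have [ea eb] := dcomp_cut rz he ha hb.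
by rewrite (dcomp_eq rz ha ea) ea eb; split=> //; case: (dcomp_le rz ha).
Qed.

(** The end of [e] nearer to [r] determines the component, so distinct decapital components have
    disjoint boundaries. *)
Lemma decapital_cut_inj r K K' e : K \in decapital r -> K' \in decapital r ->
  e \in cut K -> e \in cut K' -> K = K'.
Proof.
move=> hK hK' /cutP[a [b [he aK bK]]] /cutP[c [d [he' cK dK]]].
have [_ eK eb] := decapital_cut hK he aK bK.
have [_ eK' ed] := decapital_cut hK' he' cK dK.
have : a \in ends G e by rewrite he !inE eqxx.
have : b \in ends G e by rewrite he !inE eqxx orbT.
rewrite he' !inE => /orP[]/eqP eqb /orP[]/eqP eqa; subst; first [done | lia].
Qed.

(* [zeroed Q] and [raised r Q] are the weights and distances after contracting
   the boundaries of the members of [Q]. *)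
Definition zeroed Q e : int := if [exists K in Q, e \in cut K] then 0 else w e.

Definition raised r Q v : int := dist r v + #|[set K in Q | v \in K]|%:R.

Lemma zeroedU1 Q K : zeroed (K |: Q) = zero_cut G (zeroed Q) K.
Proof.
apply: funext => e; rewrite /zeroed /zero_cut.
case: (boolP (e \in cut K)) => ec.
  by case: existsP => // -[]; exists K; rewrite setU11.
have -> // : [exists K0 in K |: Q, e \in cut K0] = [exists K0 in Q, e \in cut K0].
apply/existsP/existsP => -[K' /andP[h h']]; exists K'; rewrite h' andbT.
  by move: h; rewrite in_setU1 => /orP[/eqP eK|//]; rewrite -eK h' in ec.
by rewrite in_setU1 h orbT.
Qed.

Lemma raisedU1 r Q K : K \notin Q -> raised r (K |: Q) = raise (raised r Q) K.
Proof.
move=> nK; apply: funext => v; rewrite /raised /raise -addrA -natrD.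
congr (_ + _%:R); rewrite addnC (cardsD1 K) !inE eqxx /=; congr (_ + _)%N.
apply: eq_card => K'; rewrite !inE; case: eqP => [->|] //=.
by rewrite (negbTE nK).
Qed.

Lemma zeroed_cut r Q K e : Q \subset decapital r -> K \in decapital r ->
  K \notin Q -> e \in cut K -> zeroed Q e = w e.
Proof.
move=> sQ hK nK ec; rewrite /zeroed; case: existsP => // -[K' /andP[hK' ec']].
by case/negP: nK; rewrite (decapital_cut_inj hK (subsetP sQ _ hK') ec ec').
Qed.

(** Once all smaller decapital components are contracted, every edge inside [K] has weight 0. *)
Lemma decapital_sink r Q K : Q \subset decapital r -> K \in decapital r ->
  K \notin Q -> (forall K', K' \in decapital r -> K' \proper K -> K' \in Q) ->
  sink G (zeroed Q) r (raised r Q) K.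
Proof.
move=> sQ hK nK sub; have /decapitalP[z [rz nr eK]] := hK; split.
- by rewrite eK.
- suff zp a : a \in K -> exists2 P, xyjoin G z a P &
      forall e, e \in P -> zeroed Q e = 0 /\ e \notin cut K.
    move=> a b /zp[P hP P0] /zp[P' hP' P0']; exists (symd P P').
      exact: xyjoin_trans (xyjoin_sym hP) hP'.
    move=> e; rewrite in_symd; case: (boolP (e \in P)) => [/P0//|_ /P0'//].
  rewrite eK in_set; move: a; apply: connect_ind.
    by exists set0 => [|e]; rewrite ?xyjoin0 ?inE.
  move=> e c d hc /= he hed [P hP P0]; exists (symd P [set e]).
    exact: xyjoin_trans hP (xyjoin1 hed).
  have cK : c \in K by rewrite eK in_set.
  have dK : d \in K.
    rewrite eK in_set; apply: connect_trans hc (connect1 _).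
    exact: (adj_edge (e := e)) hed.
  (* The edge lies on the boundary of [dcomp r u], which is a decapital component properly inside
     [K]. *)
  have inner u v : ends G e = [set u; v] -> u \in K -> v \in K ->
      dist r v = dist r u + 1 -> zeroed Q e = 0.
    move=> huv uK vK l; have [ru lu] : reach r u /\ dist r u <= dist r z.
      by apply: dcomp_le; rewrite -?eK.
    have su : dcomp r u \subset K by rewrite eK dcomp_sub -?eK.
    have nv : v \notin dcomp r u.
      by apply/negP=> /(dcomp_le ru)[_]; rewrite l gerDl.
    rewrite /zeroed; case: existsP => // -[]; exists (dcomp r u).
    rewrite (cutE _ huv) dcomp_self (negbTE nv) andbT; apply: sub.
      apply/decapitalP; exists u; split=> //; apply: contra nr.
      by rewrite -eK; apply: (subsetP su).
    by apply/properP; split=> //; exists v.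
  have e0 : zeroed Q e = 0.
    have [rc _] : reach r c /\ dist r c <= dist r z.
      by apply: dcomp_le; rewrite -?eK.
    have [l|l] := dist_edge hed rc; first exact: inner hed cK dK l.
    by apply: inner (ends_setC hed) dK cK _; rewrite l subrK.
  move=> f; rewrite in_symd in_set1; case: eqP => [->|_]; last first.
    by rewrite addbF => /P0.
  by rewrite -eK (cutE K hed) cK dK.
- move=> e a b he aK bK; have [ra eKa l] := decapital_cut hK he aK bK.
  split; last first.
    have ec : e \in cut K by rewrite (cutE K he) aK (negbTE bK).
    by rewrite (zeroed_cut sQ hK nK ec); apply: weight1.
  (* The two ends lie in the same members of [Q]: a member containing the farther end contains the
     nearer one, and a member separating them would be [K] itself. *)
  rewrite /raised l addrAC; congr (_ + _%:R + _); apply: eq_card => K'.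
  rewrite !inE; case: (boolP (K' \in Q)) => //= hK'.
  have /decapitalP[q [rq nq eq]] := subsetP sQ _ hK'.
  apply/idP/idP => h.
    rewrite eq in h *; have [_ lb] := dcomp_le rq h.
    apply: dcomp_edge rq (ends_setC he) h _; apply: le_trans lb.
    by rewrite l lerDl.
  apply: contraNT nK => bK'.
  by have [_ eK' _] := decapital_cut (subsetP sQ _ hK') he h bK'; rewrite eKa -eK'.
- by have /existsP[J hJ] := rz; exists z, J; rewrite eK dcomp_self.
Qed.

(** * Contraction of down-closed families and uniqueness of beams *)

Definition down_closed r Q := Q \subset decapital r /\
  forall K K', K \in Q -> K' \in decapital r -> K' \proper K -> K' \in Q.

Lemma down_closed_potential r Q : down_closed r Q ->
  [/\ potential G (zeroed Q) r (raised r Q),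
      forall v J, xyjoin G r v J -> wt w J = dist r v ->
        wt (zeroed Q) J = raised r Q v
    & forall a b J, xyjoin G a b J -> (forall K, K \in Q -> a \notin K /\ b \notin K) ->
        wt (zeroed Q) J <= wt w J].
Proof.
move: {2}_.+1 (ltnSn #|Q|) => n; elim: n Q => // n IH Q hn [sQ dQ].
case: (set_0Vmem Q) => [->|[K0 hK0]].
  have -> : zeroed set0 = w.
    by apply: funext => e; rewrite /zeroed; case: existsP => // -[K]; rewrite inE.
  have -> : raised r set0 = dist r.
    apply: funext => v; rewrite /raised (_ : [set _ in _ | _] = set0) ?cards0 ?addr0 //.
    by apply/setP=> K; rewrite !inE.
  by split=> //; apply: dist_potential.
(* A largest member is contracted last, so the remaining family is still down-closed. *)
pose K := [arg max_(K > K0 | K \in Q) #|K|]%N.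
have [hK maxK] : K \in Q /\ forall K', K' \in Q -> (#|K'| <= #|K|)%N.
  by rewrite /K; case: arg_maxnP.
have nK : K \notin Q :\ K by rewrite !inE eqxx.
have eQ : Q = K |: (Q :\ K) by rewrite setD1K.
have hKd := subsetP sQ _ hK.
have sQ' : Q :\ K \subset decapital r by apply: subset_trans sQ; apply: subsetDl.
have [||pot opt decr] := IH (Q :\ K).
- by move: hn; rewrite (cardsD1 K Q) hK.
- split=> // K1 K2; rewrite !in_setD1 => /andP[_ h1] h2 h12.
  rewrite (dQ _ _ h1 h2 h12) andbT.
  apply: contraTneq (maxK _ h1) => e2.
  by rewrite -ltnNge -e2 proper_card.
have snk : sink G (zeroed (Q :\ K)) r (raised r (Q :\ K)) K.
  apply: decapital_sink => // K' h' hp; rewrite in_setD1 (dQ _ _ hK h' hp) andbT.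
  by apply: contraTneq hp => ->; rewrite properxx.
rewrite eQ zeroedU1 raisedU1 //; split.
- exact: zero_cut_potential.
- by move=> v J hJ oJ; apply: (optimal_zero_cut pot snk hJ); apply: opt.
- move=> a b J hJ out; have [aK bK] := out _ (setU11 _ _).
  apply: le_trans (zero_cut_decr pot snk hJ aK bK) _.
  by apply: decr hJ _ => K' h'; apply: out; rewrite in_setU1 h' orbT.
Qed.

Definition below r K := [set K' in decapital r | K' \proper K].

Lemma below_sub r K : below r K \subset decapital r.
Proof. by apply/subsetP=> K'; rewrite inE => /andP[]. Qed.

Lemma below_notin r K : K \notin below r K.
Proof. by rewrite inE properxx andbF. Qed.

Lemma below_down r K : down_closed r (below r K).
Proof.
split=> [|K1 K2]; first exact: below_sub.
rewrite !inE => /andP[_ h1] h2 h12; apply/andP; split; first by [].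
exact: proper_trans h12 h1.
Qed.

Lemma below_sink r K : K \in decapital r ->
  sink G (zeroed (below r K)) r (raised r (below r K)) K.
Proof.
move=> hK; apply: decapital_sink => //; rewrite ?below_sub ?below_notin //.
by move=> K' h' hp; rewrite inE h'.
Qed.

(** Boundaries are disjoint, so the earlier contractions leave the boundary weights of [K]
    unchanged. *)
Lemma below_negs r K : K \in decapital r ->
  negs G (zeroed (below r K)) K = cut K :&: F.
Proof.
move=> hK; apply/setP=> e; rewrite in_setI [LHS]inE.
case: (boolP (e \in cut K)) => //= ec.
by rewrite (zeroed_cut (below_sub r K) hK (below_notin r K) ec) weightN1.
Qed.

(* Sebo's theorem *)
Lemma decapital_beam r K : K \in decapital r -> exists f, cut K :&: F = [set f].
Proof.
move=> hK; rewrite -(below_negs hK).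
have [pot _ _] := down_closed_potential (below_down r K).
exact: negs1 pot (below_sink hK).
Qed.

Lemma optimal_decapital r K z J : K \in decapital r -> z \in K -> xyjoin G r z J ->
  wt w J = dist r z -> J :&: cut K = cut K :&: F.
Proof.
move=> hK zK hJ oJ; rewrite -(below_negs hK).
have [pot opt _] := down_closed_potential (below_down r K).
exact: (optimal_setI pot (below_sink hK) zK hJ (opt _ _ hJ oJ)).
Qed.

(** After contracting [K] and everything below it, [J] closes up through [f], the inside of [K] and
    [e] at no cost. Contraction does not increase the weight of [J], as its ends lie outside. *)
Lemma decapital_outside r K e f a b y v J : K \in decapital r ->
  ends G e = [set a; y] -> a \in K -> y \notin K ->
  ends G f = [set b; v] -> b \in K -> v \notin K ->
  xyjoin G y v J -> 0 <= wt w J.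
Proof.
move=> hK he aK yK hf bK vK hJ.
have [|pot _ decr] := @down_closed_potential r (K |: below r K).
  split; first by rewrite subUset sub1set hK below_sub.
  move=> K1 K2; rewrite !in_setU1 => /orP[/eqP->|h1] h2 h12.
    by rewrite inE h2 h12 orbT.
  have [_ /(_ _ _ h1 h2 h12)->] := below_down r K; exact: orbT.
have {}decr := decr _ _ _ hJ.
apply: le_trans (decr _); last first.
  move=> K'; rewrite in_setU1 => /orP[/eqP->//|]; rewrite inE => /andP[_].
  by move=> /proper_sub/subsetP s; split; [apply: contra yK|apply: contra vK]; apply: s.
have [P hP P0] := sink_zero (below_sink hK) bK aK.
have hC := xyjoin_trans (xyjoin_trans (xyjoin_trans hJ (xyjoin_sym (xyjoin1 hf))) hP) (xyjoin1 he).
have := pot_cons pot hC; rewrite zeroedU1 !wt_symd_zero // => g.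
- rewrite inE => /eqP->; rewrite /zero_cut (cutE K hf) bK (negbTE vK) //.
- by move=> /P0[g0 _]; rewrite /zero_cut g0 if_same.
- rewrite inE => /eqP->; rewrite /zero_cut (cutE K he) aK (negbTE yK) //.
Qed.

Lemma decapital_inside r K e x y z : K \in decapital r ->
  cut K :&: F = [set e] -> ends G e = [set x; y] -> x \in K -> y \notin K ->
  z \in K -> exists2 J, xyjoin G y z J & wt w J <= -1.
Proof.
move=> hK beam he xK yK zK.
have [rx eK l] := decapital_cut hK he xK yK.
have [rz lz] : reach r z /\ dist r z <= dist r x by apply: dcomp_le; rewrite -?eK.
have [J hJ oJ] := dist_att rz.
have eJ := optimal_decapital hK zK hJ oJ; rewrite beam in eJ.
have /andP[eJ' ecut] : (e \in J) && (e \in cut K) by rewrite -in_setI eJ inE.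
(* [J] crosses the boundary only at [e], so it splits into an outer part, [e], and an inner part
   [Ji] joining [x] to [z]. *)
pose Ji := [set f in J | ends G f \subset K].
pose Jo := [set f in J | ends G f \subset ~: K].
have degi v : v \notin K -> deg G Ji v = false.
  move=> vK; apply: big1 => f _; rewrite inE.
  case: (boolP (ends G f \subset K)) => [/subsetP s|]; rewrite ?andbF // andbT.
  by case: (boolP (v \in ends G f)) => [/s|]; rewrite ?(negbTE vK) ?andbF.
have dego v : v \in K -> deg G Jo v = false.
  move=> vK; apply: big1 => f _; rewrite inE.
  case: (boolP (ends G f \subset ~: K)) => [/subsetP s|]; rewrite ?andbF // andbT.
  by case: (boolP (v \in ends G f)) => [/s|]; rewrite ?inE ?vK ?andbF.
have splitJ : J = symd (symd Ji [set e]) Jo.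
  apply/setP=> f; rewrite !in_symd in_set1 [f \in Ji]inE [f \in Jo]inE -in_set1 -eJ.
  rewrite in_setI; case: (f \in J) => //=.
  have [a [b hf]] := endsP G f; rewrite (cutE K hf) hf !subUset !sub1set !in_setC.
  by case: (a \in K); case: (b \in K).
have hJi : xyjoin G x z Ji.
  apply/xyjoinP=> v; case: (boolP (v \in K)) => vK; last first.
    rewrite degi //; case: eqP => [ev|_]; first by rewrite ev xK in vK.
    by case: eqP => // ev; rewrite ev zK in vK.
  have /xyjoinP/(_ v) := hJ; rewrite splitJ !deg_symd dego // addbF.
  have /xyjoinP-> := xyjoin1 he.
  have -> : (v == y) = false by apply: contraNF yK => /eqP<-.
  have -> : (v == r) = false by apply: contraNF (decapital_root hK) => /eqP<-.
  by rewrite addbF /= => <-; case: (v == x); case: (deg G Ji v).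
have sJi : Ji \subset J by apply/subsetP=> f; rewrite inE => /andP[].
have eJi : e \notin Ji.
  rewrite inE eJ' he subUset !sub1set (negbTE yK) !andbF //.
have wN : w e = -1.
  have : e \in cut K :&: F by rewrite beam inE.
  by rewrite in_setI -weightN1 => /andP[_ /eqP].
exists (symd Ji [set e]).
  have := xyjoin_trans (xyjoin_sym (xyjoin1 he)) hJi.
  by rewrite symdC.
(* Removing [Ji] and [e] from [J] leaves a set joining [r] to [y], and [y] is one farther than [x];
   hence [Ji] weighs at most [dist r z - dist r x], which is at most 0. *)
have := dist_le (xyjoin_trans (xyjoin_trans hJ (xyjoin_sym hJi)) (xyjoin1 he)).
rewrite !wt_symd1 (symd_setD sJi) in_setD eJi eJ' /= (negbTE eJi) wN.
by have := wt_setD w sJi; move: lz oJ l; clear; lia.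
Qed.

End Distance.

(** * The component with a given beam, seen from the antiroot *)

Section Uniqueness.
Variables (V E : finType) (G : graph V E) (F : {set E}).
Implicit Types (r x y z : V) (e : E) (C : {set E}) (K : {set V}).
Local Notation w := (weight F).
Local Notation dist := (dist G F).
Local Notation dcomp := (dcomp G F).
Local Notation decapital := (decapital G F).

Hypothesis cons : forall a C, xyjoin G a a C -> 0 <= wt w C.
Hypothesis even : forall a C, xyjoin G a a C -> exists k : int, wt w C = k + k.

Lemma dist_antiroot e x y : e \in F -> ends G e = [set x; y] -> dist y x = -1.
Proof.
move=> eF he; have we : w e = -1 by apply/eqP; rewrite weightN1.
have hyx := xyjoin_sym (xyjoin1 he); apply/eqP; rewrite eq_le -{1}we -(wt1 w e) dist_le //=.
have [J hJ <-] := dist_att F (reachI hyx).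
have := cons (xyjoin_trans hJ (xyjoin1 he)); rewrite wt_symd1 we.
by case: ifP; lia.
Qed.

Lemma antiroot_decapital e x y : e \in F -> ends G e = [set x; y] ->
  reach G y x /\ dcomp y x \in decapital y.
Proof.
move=> eF he; have rx : reach G y x := reachI (xyjoin_sym (xyjoin1 he)).
split=> //; apply/decapitalP; exists x; split=> //.
apply/negP=> /(dcomp_le cons rx)[_].
by rewrite (dist_antiroot eF he) (dist_root cons).
Qed.

(** All of [K] is within distance -1 of [y] and [K] is connected, giving one inclusion. For the
    other, an edge leaving [K] within that level would reach an outer neighbour at negative distance
    from [y]. *)
Lemma decapital_beam_unique r K e x y : K \in decapital r ->
  cut G K :&: F = [set e] -> ends G e = [set x; y] -> x \in K -> y \notin K ->
  K = dcomp y x.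
Proof.
move=> hK beam he xK yK.
have /andP[ecut eF] : (e \in cut G K) && (e \in F) by rewrite -in_setI beam inE.
have [rx _] := antiroot_decapital eF he; have dx := dist_antiroot eF he.
have [rx' eK _] := decapital_cut cons even hK he xK yK.
have inK z : z \in K -> dist y z <= dist y x.
  rewrite dx => /(decapital_inside cons even hK beam he xK yK)[J hJ].
  exact/le_trans/dist_le.
apply/eqP; rewrite eqEsubset; apply/andP; split; apply/subsetP=> u.
  rewrite {1}eK => hu; rewrite in_dcomp in hu; move: u hu.
  apply: (@connect_ind _ _ _ _ (fun u => u \in dcomp y x)).
    exact: dcomp_self.
  move=> f c d hc /= hf hcd; move/(dcomp_edge cons rx hcd); apply; apply: inK.
  rewrite eK in_dcomp; apply: connect_trans hc (connect1 _).
  exact: (adj_edge (e := f)) hcd.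
rewrite in_dcomp; move: u.
apply: (@connect_ind _ _ _ _ (fun u => u \in K)) => // f c d hc /= hf hcd cK.
apply/negPn/negP=> dK.
have : d \in dcomp y x.
  rewrite in_dcomp; apply: connect_trans hc (connect1 _).
  exact: (adj_edge (e := f)) hcd.
move=> /(dcomp_le cons rx)[rd]; have [J hJ <-] := dist_att F rd.
have := decapital_outside cons even hK he xK yK hcd cK dK hJ.
by rewrite dx => h /(le_trans h).
Qed.

End Uniqueness.

(** * Minimum joins in bipartite graphs *)

Section MinimumJoin.
Variables (V E : finType) (G : graph V E) (T : {set V}) (F : {set E}).
Implicit Types (C : {set E}).
Local Notation w := (weight F).

Lemma weight_flip : w = flip (fun=> 1) F.
Proof. by apply: funext. Qed.

Lemma wt_card (A : {set E}) : wt (fun=> 1) A = #|A|%:R.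
Proof. by rewrite /wt sumr_const. Qed.

(** [symd C F] is again a join, and the weight of [C] is the difference of the two cardinalities. *)
Lemma minimum_join_cons a C : minimum_join G T F -> xyjoin G a a C -> 0 <= wt w C.
Proof.
move=> [jF minF] /xyjoinP hC.
rewrite weight_flip wt_flip !wt_card subr_ge0 ler_nat; apply: minF => v.
by rewrite deg_odd deg_symd hC addbb /= -deg_odd jF.
Qed.

(** Every edge crosses the bipartition, so an even-degree set has even cardinality. *)
Lemma bipartite_even a C : bipartite G -> xyjoin G a a C ->
  exists k : int, wt w C = k + k.
Proof.
move=> [X hX] hC; have := odd_cut_xyjoin X hC; rewrite addbb.
have /setIidPl-> : C \subset cut G X by apply/subsetP=> e _.
rewrite weight_flip wt_flip; have [k ->] := wt_symd (fun=> 1) C F.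
rewrite wt_card => oC; exists ((#|C|./2)%:R + k).
have := odd_double_half #|C|; rewrite oC -addnn; lia.
Qed.

End MinimumJoin.

(** * From vertex sets back to subgraphs, and the theorem *)

Lemma component_induced (V E : finType) (G : graph V E) X K :
  is_component G (induced G X) K ->
  sverts K \subset X /\ sedges K = [set e | ends G e \subset sverts K].
Proof.
move=> [q /= qX ->] /=; set C := [set u | _].
have CX : C \subset X.
  apply/subsetP=> u; rewrite inE; move: u; apply: connect_ind => //= e c d _.
  by rewrite inE => /subsetP s h _; apply: s; rewrite h !inE eqxx orbT.
split=> //; apply/setP=> e; rewrite !inE; case: (boolP (_ \subset C)) => //= h.
  by rewrite (subset_trans h CX).
by rewrite andbF.
Qed.

Lemma subgraph_eq (V E : finType) (H K : subgraph V E) :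
  sverts H = sverts K -> sedges H = sedges K -> H = K.
Proof. by case: H => ? ?; case: K => ? ? /= -> ->. Qed.

Theorem theorem6p8 (V E : finType) (G : graph V E) (T : {set V})
    (F : {set E}) :
  graft G T -> bipartite G -> minimum_join G T F ->
  forall (e : E) (x y : V), e \in F -> ends G e = [set x; y] ->
  exists! K : subgraph V E,
    (exists r : V, decapital_distance_component G F r K) /\
    is_Froot G F K x /\ is_Fantiroot G F K y.
Proof.
move=> _ bip mj e x y eF he.
have cons a C : xyjoin G a a C -> 0 <= wt (weight F) C := minimum_join_cons mj.
have even a C : xyjoin G a a C -> exists k : int, wt (weight F) C = k + k :=
  @bipartite_even _ _ _ F a C bip.
have [rx hD] := antiroot_decapital cons eF he.
have xD := dcomp_self G F y x; have yD := decapital_root hD.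
pose K := component_at G (induced G (level_le G F y (dist G F y x))) x.
have cK : is_component G (induced G (level_le G F y (dist G F y x))) K.
  by exists x => //=; rewrite in_level // rx /=.
have sK : sverts K = dcomp G F y x by [].
clearbody K.
exists K; split.
  have beam : is_beam G F K e.
    have [f ef] := decapital_beam cons even hD; rewrite /is_beam sK ef.
    suff : e \in [set f] by rewrite inE => /eqP->.
    by rewrite -ef in_setI eF (cutE _ he) xD (negbTE yD).
  split.
    exists y; split; last by rewrite sK.
    exists (dist G F y x); split; last exact: cK.
    by exists x; apply/is_distP.
  by split; exists e => //; rewrite ?in_setI ?in_setD he in_set2 sK eqxx ?orbT ?xD ?yD.
move=> K' [[r [[i [_ cK']] rK']]] [[e1 b1]].
rewrite in_setI => /andP[xe xK'] [e2 b2]; rewrite in_setD => /andP[yK' ye].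
have ecut : e \in cut G (sverts K') by rewrite (cutE _ he) xK' (negbTE yK').
have beam : cut G (sverts K') :&: F = [set e].
  have : e \in cut G (sverts K') :&: F by rewrite in_setI ecut.
  by rewrite b1 in_set1 => /eqP->.
have [sX eK'] := component_induced cK'; have [_ eK] := component_induced cK.
have hx : x \in level_le G F r i by apply: (subsetP sX).
move: (hx); rewrite in_level // => /andP[rx' lx].
have ry := reach_edge he rx'.
have [q qX defK'] := cK'.
have qx : connect (adj G (induced G (level_le G F r i))) q x.
  by move: xK'; rewrite defK' inE.
(* [y] is adjacent to [x] but outside [K'], so it lies above level [i]. As distances change by one
   along an edge, [x] is exactly on level [i], and [K'] is its level component. *)
have ly : ~~ (dist G F r y <= i).
  apply: contra yK' => ly; rewrite defK' inE; apply: connect_trans qx (connect1 _).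
  apply: (adj_edge (e := e)) (he); rewrite inE he; apply/subsetP=> v.
  by rewrite in_set2 => /orP[] /eqP-> //; rewrite in_level // ry.
have ei : dist G F r x = i.
  by have := dist_edge even he rx'; move: lx ly; clear; lia.
have sK' : sverts K' = dcomp G F r x.
  rewrite defK' /dcomp /= ei; apply/setP=> u; rewrite !inE.
  by rewrite (same_connect (@connect_adj_sym _ _ G _) qx).
have hD' : sverts K' \in decapital G F r.
  by apply/decapitalP; exists x; split; [exact: rx'|rewrite -sK'|exact: sK'].
have eqs : sverts K' = sverts K.
  by rewrite (decapital_beam_unique cons even hD' beam he xK' yK').
by apply: subgraph_eq; rewrite ?eK ?eK' eqs.
Qed.
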